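(* Let $\sigma$ be a connected matching and set $\chi=123132$, $\overline{\chi}=123213$. Writing $M(z)=\mathcal{M}(\sigma,\chi,\overline{\chi},z)$, we have $$\mathcal{M}(1(\sigma+1)1,\chi,\overline{\chi},z)=\frac{1}{1-zM(z)\,C\!\left(zM(z)^{2}\right)}.$$
   Context: A matching of order $n$ is a partition of $[2n]$ into blocks (edges) of size two, identified with the word in $[n]^{2n}$ where both vertices of an edge carry the same letter and letters appear in increasing order of left vertices. A matching $\sigma$ of order $k$ is a pattern of $\tau$ if there are $i_1<\dots<i_{2k}$ with $\{i_p,i_q\}\in\tau$ iff $\{p,q\}\in\sigma$; otherwise $\tau$ avoids $\sigma$. For a set $S$ of matchings, $\mathcal{M}_n(S)$ is the set of matchings of order $n$ avoiding all of $S$, and $\mathcal{M}(S,z)=\sum_{n\ge0}|\mathcal{M}_n(S)|z^n$ (the empty matching counts for $n=0$). The juxtaposition of $\alpha,\beta$ is the word of $\alpha$ followed by the word of $\beta$ with $|\alpha|$ added to each letter; a matching is connected if it is nonempty and is not the juxtaposition of two nonempty matchings. $1(\sigma+1)1$ (the lifting of $\sigma$) is the word consisting of the letter $1$, then the word of $\sigma$ with $1$ added to each letter, then $1$. $C(z)=\sum_{n\ge0}\frac{1}{n+1}\binom{2n}{n}z^n$. *)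

(* Defs.v *)
From mathcomp Require Import all_boot all_order all_algebra.
Set Implicit Arguments. Unset Strict Implicit. Unset Printing Implicit Defensive.
Import GRing.Theory.

(* A matching of order n, identified with its word in [n]^{2n}:
   letters 1..n, each letter occurs exactly twice (the two vertices of an
   edge), and letters appear in increasing order of their left vertices
   (first occurrences). *)
Definition is_matching (n : nat) (w : seq nat) : bool :=
  [&& size w == n.*2,
      all (fun x => 0 < x <= n) w,
      all (fun i => count_mem i w == 2) (iota 1 n) &
      [forall i : 'I_n.+1, forall j : 'I_n.+1,
         ((0 < i) && (i < j)) ==> (index (i : nat) w < index (j : nat) w)]].

(* sigma is a pattern of tau: there are positions i_1 < ... < i_{2k}
   (selected by a boolean mask m on the positions of tau, 2k = size sigma)
   such that {i_p,i_q} is an edge of tau iff {p,q} is an edge of sigma,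
   i.e. tau_{i_p} = tau_{i_q} iff sigma_p = sigma_q. *)
Definition contains (tau sigma : seq nat) : bool :=
  [exists m : (size tau).-tuple bool,
    let t := mask m tau in
    (size t == size sigma) &&
    [forall p : 'I_(size sigma), forall q : 'I_(size sigma),
      (nth 0 t p == nth 0 t q) == (nth 0 sigma p == nth 0 sigma q)]].

Definition avoids (tau sigma : seq nat) : bool := ~~ contains tau sigma.

(* |M_n(S)| : number of matchings of order n avoiding every pattern in S.
   Words are enumerated as (2n)-tuples over 'I_(n+1) (injective via val). *)
Definition Mcount (S : seq (seq nat)) (n : nat) : nat :=
  #|[set t : (n.*2).-tuple 'I_n.+1 |
      is_matching n (map val t) && all (avoids (map val t)) S]|.

Definition juxt (i : nat) (a b : seq nat) : seq nat := a ++ map (addn i) b.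

Definition connected (k : nat) (sigma : seq nat) : Prop :=
  0 < k /\
  ~ (exists i j a b, [/\ 0 < i, 0 < j, is_matching i a, is_matching j b &
                        sigma = juxt i a b]).

Definition lifting (sigma : seq nat) : seq nat :=
  1 :: rcons (map S sigma) 1.

Definition chi : seq nat := [:: 1; 2; 3; 1; 3; 2].
Definition chibar : seq nat := [:: 1; 2; 3; 2; 1; 3].

Local Open Scope ring_scope.
Definition ps := nat -> rat.
Definition ps1 : ps := fun n => (n == 0%N)%:R.
Definition psX : ps := fun n => (n == 1%N)%:R.
Definition psmul (f g : ps) : ps :=
  fun n => \sum_(i < n.+1) f i * g (n - i)%N.
Fixpoint pspow (f : ps) (k : nat) : ps :=
  if k is k'.+1 then psmul f (pspow f k') else ps1.
Definition catalan_coef (k : nat) : rat := ('C(k.*2, k))%:R / (k.+1)%:R.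
(* C(G) for a series G with zero constant term: coefficient n only involves
   the terms k <= n since G^k has order >= k. *)
Definition psC_comp (G : ps) : ps :=
  fun n => \sum_(k < n.+1) catalan_coef k * pspow G k n.
(* 1/(1 - F) = sum_j F^j for a series F with zero constant term. *)
Definition ps_inv1m (F : ps) : ps :=
  fun n => \sum_(j < n.+1) pspow F j n.
Definition Mgf (S : seq (seq nat)) : ps := fun n => (Mcount S n)%:R.

(* Main.v *)
Require Import Defs.
From Stdlib Require Import Ring FunctionalExtensionality.
From mathcomp Require Import all_boot all_order all_algebra zify.
Set Implicit Arguments. Unset Strict Implicit. Unset Printing Implicit Defensive.
Import GRing.Theory Num.Theory.

(** A matching avoids [chi] and [chibar] iff the set of edges nested in any given edge is closed
under crossing.  Hence the outer edges (those nested in no other edge) form a nonnesting matching,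
whose closers follow a first-in first-out queue, and the remaining edges fill the gaps between
consecutive outer vertices lying below some outer edge, each gap independently.  As [sigma] is
connected, the whole avoids the lifting of [sigma] iff every filling avoids [sigma].  Reading a
matching from left to right and writing [W_h] for the series of its possible suffixes when [h]
outer edges are open, this gives [W_0 = 1 + z M W_1], [W_1 = W_0 + z M W_2] and
[W_(h+2) = M W_(h+1) + z M W_(h+3)], whose solution is
[W_0 = 1 / (1 - z M C)], [W_(h+1) = (M C)^h C W_0] with [C = 1 + z M^2 C^2]. *)

(** * Occurrences and canonical words *)

(** Occurrences are described by a renaming of letters instead of a choice of positions: the
    equalities between letters then come for free, and [subseq] carries the combinatorics. *)
Definition occurs (s t : seq nat) : Prop :=
  exists2 g : nat -> nat, {in s &, injective g} & subseq (map g s) t.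

(** The renaming sends a letter of [s] to the letter selected at its first position. The equivalence
    required by [contains] makes this independent of the position and injective. *)
Lemma containsP t s : reflect (occurs s t) (contains t s).
Proof.
apply: (iffP existsP) => [[m /andP [/eqP sz /forallP iso]]|[g inj /subseqP [m szm E]]].
  pose g y := nth 0 (mask m t) (index y s).
  have isoP p q : p < size s -> q < size s ->
      (nth 0 (mask m t) p == nth 0 (mask m t) q) = (nth 0 s p == nth 0 s q).
    by move=> lp lq; move/forallP: (iso (Ordinal lp)) => /(_ (Ordinal lq)) /eqP.
  exists g => [x y xs ys /eqP|].
    by rewrite /g isoP ?index_mem // !nth_index // => /eqP.
  suff -> : map g s = mask m t by exact: mask_subseq.
  apply: (@eq_from_nth _ 0) => [|p]; rewrite size_map ?sz // => lp.
  rewrite (nth_map 0) // /g; apply/eqP.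
  by rewrite isoP ?index_mem ?mem_nth // nth_index ?mem_nth.
have szm' : size m == size t by apply/eqP.
exists (Tuple szm'); rewrite /= -E size_map eqxx /=.
apply/forallP => p; apply/forallP => q; rewrite !(nth_map 0) //; apply/eqP.
by apply/eqP/eqP => [/inj|->//]; apply; rewrite mem_nth.
Qed.

Lemma occurs_subseq s t t' : occurs s t -> subseq t t' -> occurs s t'.
Proof. by case=> g inj sub /(subseq_trans sub); exists g. Qed.

Lemma occurs_map_inv s h t : occurs s t -> injective h -> occurs s (map h t).
Proof.
case=> g inj sub inj_h; exists (h \o g); last by rewrite map_comp map_subseq.
by move=> x y xs ys /inj_h /inj; apply.
Qed.

(** The renaming [g] is pulled back along [h] by reading the letters of [t] at the selected
    positions, so no inverse of [h] is required. *)
Lemma occurs_map s h t : occurs s (map h t) -> {in t &, injective h} -> occurs s t.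
Proof.
case=> g inj /subseqP [m szm E] inj_h; rewrite -map_mask in E.
set t' := mask m t in E.
have sz : size s = size t' by move/(congr1 size): E; rewrite !size_map.
have tt x : x \in t' -> x \in t by exact: mem_mask.
have nthE p : p < size s -> g (nth 0 s p) = h (nth 0 t' p).
  by move=> lp; move/(congr1 (nth 0 ^~ p)): E; rewrite !(nth_map 0) -?sz.
exists (fun y => nth 0 t' (index y s)) => [x y xs ys|].
  move/(congr1 h); rewrite -!nthE ?index_mem // !nth_index //; exact: inj.
suff -> : map (fun y => nth 0 t' (index y s)) s = t' by exact: mask_subseq.
apply: (@eq_from_nth _ 0) => [|p]; rewrite size_map ?sz // => lp.
have lp' : p < size s by rewrite sz.
rewrite (nth_map 0) //; apply: inj_h; rewrite ?tt ?mem_nth // -?sz ?index_mem ?mem_nth //.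
by rewrite -!nthE ?index_mem ?mem_nth // nth_index // mem_nth.
Qed.

(** * Subsequences of words with few repetitions *)

Lemma subseq_cat_inv (t a b : seq nat) : subseq t (a ++ b) ->
  exists t1 t2, [/\ t = t1 ++ t2, subseq t1 a & subseq t2 b].
Proof.
elim: a t => [|x a IH] t /=; first by exists [::], t.
case: t => [|y t]; first by exists [::], [::]; rewrite !sub0seq.
case: eqP => [->|neq] /IH [t1 [t2 [E s1 s2]]].
  by exists (x :: t1), t2; rewrite E /= eqxx.
exists t1, t2; split=> //; apply: subseq_trans s1 (subseq_cons _ _).
Qed.

Lemma subseq_del (x : nat) t p s :
  x \notin t -> subseq t (p ++ x :: s) -> subseq t (p ++ s).
Proof.
move=> xt sub; have : subseq t (filter (predC1 x) (p ++ x :: s)).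
  rewrite subseq_filter sub andbT; apply/allP => y yt /=.
  by apply: contraNneq xt => <-.
rewrite filter_cat /= eqxx -filter_cat => /subseq_trans -> //.
exact: filter_subseq.
Qed.

Lemma subseq_skip (t f r : seq nat) :
  (forall c, c \in t -> c \notin f) -> subseq t (f ++ r) -> subseq t r.
Proof.
move=> dis /subseq_cat_inv [t1 [t2 [E s1 s2]]].
case: t1 E s1 => [|x t1] E s1; first by rewrite E.
have := mem_subseq s1 (mem_head _ _).
by rewrite (negPf (dis _ _)) // E mem_head.
Qed.

Lemma subseq_split (x : nat) a b p s : x \notin p -> x \notin s ->
  subseq (a ++ x :: b) (p ++ x :: s) -> subseq a p /\ subseq b s.
Proof.
move=> xp xs; elim: p a xp => [|z p IH] a /=.
  move=> _; case: a => [|y a] /=; first by rewrite eqxx.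
  move=> sub; case/negP: xs; apply: (mem_subseq sub).
  by case: eqP; rewrite ?inE mem_cat mem_head !orbT.
rewrite inE negb_or => /andP [xz xp]; case: a => [|y a] /=.
  by rewrite (negPf xz) => /(IH [::] xp) [_ ->].
case: eqP => _; first by move/(IH a xp).
by move/(IH (y :: a) xp); case: p {IH xp}.
Qed.

Lemma count_gt0 (c : nat) u : (0 < count_mem c u) = (c \in u).
Proof. by rewrite -has_count has_pred1. Qed.

Lemma count_mem_cons (c x : nat) u : count_mem c (x :: u) = (x == c) + count_mem c u.
Proof. by []. Qed.

(** Cutting [u] at its only [b] would put one [c] on each side. This expresses that two edges of the
    queue cannot close in both orders. *)
Lemma subseq_pair_anti (b c : nat) u :
  b != c -> count_mem b u = 1 -> count_mem c u <= 1 ->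
  subseq [:: b; c] u -> ~ subseq [:: c; b] u.
Proof.
move=> neq cb cc.
have bu : b \in u by rewrite -count_gt0 cb.
case/splitPr: bu cb cc => p s; rewrite !count_cat !count_mem_cons eqxx => cb cc.
have bp : b \notin p by rewrite -count_gt0; lia.
have bs : b \notin s by rewrite -count_gt0; lia.
move/(@subseq_split b [::] [:: c] _ _ bp bs) => [_ /mem_subseq /(_ c (mem_head _ _))].
rewrite -count_gt0 => c1.
move/(@subseq_split b [:: c] [::] _ _ bp bs) => [/mem_subseq /(_ c (mem_head _ _))].
rewrite -count_gt0 => c2; lia.
Qed.

(* New letters (those above [m]) appear as [m+1], [m+2], and so on. *)
Fixpoint canon (m : nat) (u : seq nat) : bool :=
  if u is x :: u' then (x <= m.+1) && canon (maxn m x) u' else true.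

Definition top (m : nat) (u : seq nat) : nat := foldl maxn m u.

Lemma canon_cat m u v : canon m (u ++ v) = canon m u && canon (top m u) v.
Proof. by elim: u m => //= x u IH m; rewrite IH andbA. Qed.

Lemma leq_top m u : m <= top m u.
Proof. by elim: u m => //= x u IH m; apply: leq_trans (IH _); rewrite leq_maxl. Qed.

(** A canonical word skips no letter on its way up to its maximum. *)
Lemma canon_mem m u c : canon m u -> m < c -> (c \in u) = (c <= top m u).
Proof.
elim: u m => /= [m _|x u IH m /andP [lex can] ltmc]; first by rewrite ltnNge => /negbTE.
rewrite inE; case: (eqVneq c x) => [cx|neq] /=.
  by symmetry; apply: leq_trans (leq_top _ _); rewrite cx leq_maxr.
by apply: IH can _; lia.
Qed.

Lemma mem_leq_top m u c : c \in u -> c <= top m u.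
Proof.
elim: u m => //= x u IH m; rewrite inE => /orP [/eqP ->|/IH //].
by apply: leq_trans (leq_top _ _); rewrite leq_maxr.
Qed.

Lemma canon_shift m a u : canon (m + a) (map (addn m) u) = canon a u.
Proof.
by elim: u a => //= x u IH a; rewrite -addn_maxr IH -addnS leq_add2l.
Qed.

Lemma canonP m u :
  (forall p x r, u = p ++ x :: r -> x <= (top m p).+1) -> canon m u.
Proof.
elim: u m => //= x u IH m H; rewrite (H [::] x u) //=.
by apply: IH => p y r E; rewrite (H (x :: p) y r) // E.
Qed.

(** The word of a matching of order [n] with all letters raised by [m], as it appears after [m]
    edges have been opened. *)
Definition block (m n : nat) (u : seq nat) : Prop :=
  canon m u /\ forall c, count_mem c u = if m < c <= m + n then 2 else 0.

Lemma block_mem m n u c : block m n u -> (c \in u) = (m < c <= m + n).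
Proof. by case=> _ cnt; rewrite -count_gt0 cnt; case: ifP. Qed.

Lemma block_top m n u : block m n u -> top m u = m + n.
Proof.
move=> blk; have memE c : m < c -> (c <= top m u) = (c <= m + n).
  by case: (blk) => can _ mc; rewrite -(canon_mem can mc) (block_mem _ blk) mc.
have := leq_top m u; have := memE (top m u); have := memE (m + n); lia.
Qed.

Lemma block_size m n u : block m n u -> size u = n.*2.
Proof.
case=> _ cnt; have /perm_size -> : perm_eq u (iota m.+1 n ++ iota m.+1 n).
  apply/allP => c _ /=; rewrite cnt count_cat count_uniq_mem ?iota_uniq // mem_iota.
  by rewrite addSn ltnS; case: ifP.
by rewrite size_cat size_iota addnn.
Qed.

Lemma block_intro m u : canon m u ->
  (forall c, c \in u -> m < c /\ count_mem c u = 2) -> block m (top m u - m) u.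
Proof.
move=> can H; split=> // c; rewrite subnKC ?leq_top //; case: ifPn => [/andP [mc ct]|].
  by case: (H c); rewrite // (canon_mem can mc).
move=> nc; apply/eqP; rewrite -leqn0 leqNgt count_gt0; apply: contra nc => cu.
by rewrite mem_leq_top // andbT; case: (H c cu).
Qed.

Lemma block_shift m n w : block m n (map (addn m) w) <-> block 0 n w.
Proof.
have cntE c : count_mem (m + c) (map (addn m) w) = count_mem c w.
  by rewrite count_map; apply: eq_count => x /=; rewrite eqn_add2l.
rewrite /block -{1}[m]addn0 canon_shift; split=> -[can cnt]; split=> // c.
  by rewrite -cntE cnt leq_add2l -{1}[m]addn0 ltn_add2l.
case: (leqP m c) => [mc|cm]; last first.
  rewrite (_ : (m < c <= m + n) = false); last lia.
  apply/eqP; rewrite -leqn0 leqNgt count_gt0; apply/mapP => -[x _ E]; lia.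
by rewrite -(subnKC mc) cntE cnt leq_add2l -{3}[m]addn0 ltn_add2l.
Qed.

Lemma block_unshift m n u : block m n u -> exists2 w, u = map (addn m) w & block 0 n w.
Proof.
move=> blk; have E : map (addn m) (map (subn^~ m) u) = u.
  rewrite -map_comp -[RHS]map_id; apply/eq_in_map => x; rewrite (block_mem _ blk) /=; lia.
by exists (map (subn^~ m) u); rewrite ?E // -(block_shift m) E.
Qed.

(** If a letter exceeded the running maximum by more than one, the skipped letter would appear first
    only later, against the order of first occurrences. Conversely, the prefix before the first [j]
    is canonical and hence already contains every positive [i < j]. *)
Lemma matchingP n w : reflect (block 0 n w) (is_matching n w).
Proof.
apply: (iffP and4P) => [[/eqP sz /allP lets /allP cnt /forallP ord]|blk].
  have cntE c : 0 < c <= n -> count_mem c w = 2.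
    by move=> cn; apply/eqP/cnt; rewrite mem_iota; lia.
  split=> [|c]; last first.
    rewrite add0n; case: ifPn => [/cntE //|nc]; apply/eqP.
    by rewrite -leqn0 leqNgt count_gt0; apply: contra nc => /lets.
  apply: canonP => p x r E; rewrite leqNgt; apply/negP => lt.
  have xw : x \in w by rewrite E mem_cat mem_head orbT.
  have /andP [_ xn] := lets x xw.
  set y := (top 0 p).+1 in lt.
  have yn : y < n.+1 by lia.
  move/forallP: (ord (Ordinal yn)) => /(_ (Ordinal (xn : x < n.+1))) /= /implyP.
  rewrite lt => /(_ isT); rewrite E !index_cat.
  have np z : y <= z -> (z \in p) = false.
    by move=> yz; apply/negP => /(mem_leq_top 0); rewrite /y in yz; lia.
  by rewrite !np ?(ltnW lt) //= eqxx addn0 ltnNge leq_addr.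
have [can cnt] := blk; split.
- by rewrite (block_size blk).
- by apply/allP => c; rewrite (block_mem _ blk).
- by apply/allP => c; rewrite mem_iota => cn; rewrite cnt (_ : (_ < _ <= _) = true) //; lia.
apply/forallP => -[i lti]; apply/forallP => -[j ltj] /=; apply/implyP => /andP [i0 ij].
have jw : j \in w by rewrite (block_mem _ blk); lia.
have ltj' : index j w < size w by rewrite index_mem.
rewrite -in_take_leq ?(ltnW ltj') //; move: can.
rewrite -{1}[w](cat_take_drop (index j w)) (drop_nth 0) // nth_index //.
rewrite canon_cat /= => /andP [can /andP [le_j _]].
by rewrite (canon_mem can) //; lia.
Qed.

(** * Patterns in a word read with a queue of open edges *)

Definition avoiding (sigma w : seq nat) : Prop :=
  [/\ ~ occurs (lifting sigma) w, ~ occurs chi w & ~ occurs chibar w].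

Lemma avoiding_subseq sigma w w' : avoiding sigma w' -> subseq w w' -> avoiding sigma w.
Proof. by case=> *; split=> /occurs_subseq; eauto. Qed.

Lemma occurs3 s a b c w : {subset s <= [:: 1; 2; 3]} -> uniq [:: a; b; c] ->
  subseq (map (nth 0 [:: 0; a; b; c]) s) w -> occurs s w.
Proof.
move=> sub; rewrite /= !inE => uq; exists (nth 0 [:: 0; a; b; c]) => // x y /sub xs /sub ys.
move: xs ys uq; rewrite !inE.
by case/or3P=> /eqP -> /or3P [] /eqP -> //=; lia.
Qed.

Lemma occurs_chi a b c w : uniq [:: a; b; c] ->
  subseq [:: a; b; c; a; c; b] w -> occurs chi w.
Proof. by move=> uq; apply: (@occurs3 chi a b c) => // x; rewrite !inE; lia. Qed.

Lemma occurs_chibar a b c w : uniq [:: a; b; c] ->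
  subseq [:: a; b; c; b; a; c] w -> occurs chibar w.
Proof. by move=> uq; apply: (@occurs3 chibar a b c) => // x; rewrite !inE; lia. Qed.

Lemma mem_lifting sigma c :
  (c \in lifting sigma) = (c == 1) || (c \in map S sigma).
Proof. by rewrite inE mem_rcons inE orbA orbb. Qed.

(** The letter 1 of the lifting goes to [z] and [c.+1] goes to the image of [c]; as 0 is not a
    letter of [sigma], the two cases do not collide. *)
Lemma occurs_lifting sigma z f : z \notin f -> 0 \notin sigma ->
  occurs sigma f -> occurs (lifting sigma) (z :: rcons f z).
Proof.
move=> zf s0 [g inj sub].
have gf c : c \in sigma -> g c \in f by move=> cs; apply: (mem_subseq sub); apply: map_f.
exists (fun c => if c == 1 then z else g c.-1); last first.
  rewrite /= eqxx map_rcons eqxx -!cats1 cat_subseq // -map_comp.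
  rewrite (@eq_in_map _ _ _ g sigma).1 // => c cs /=.
  by case: c cs => //= cs; rewrite cs in s0.
move=> x y; rewrite !mem_lifting.
case: (eqVneq x 1) => [->|x1] /=; case: (eqVneq y 1) => [->|y1] //=.
- by move=> _ /mapP [c cs ->] E; rewrite E gf in zf.
- by case/mapP => [c cs ->] _ E; rewrite -E gf in zf.
by case/mapP => [c cs ->] /mapP [d ds ->] E; congr S; apply: inj.
Qed.

Lemma occurs_of_lifting sigma w : occurs (lifting sigma) w -> occurs sigma w.
Proof.
case=> g inj sub; exists (g \o S) => [x y xs ys E|].
  by apply: succn_inj; apply: inj E; rewrite mem_lifting map_f ?orbT.
apply: subseq_trans sub; rewrite map_comp /= map_rcons.
exact: subseq_trans (subseq_rcons _ _) (subseq_cons _ _).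
Qed.

Lemma leq_count_map (g : nat -> nat) c s : count_mem c s <= count_mem (g c) (map g s).
Proof. by rewrite count_map; apply: sub_count => y /= /eqP ->. Qed.

(** An occurrence either starts at the leading [x], or lies in a word with a single [x]; in the
    latter case it cannot use [x], since each of its letters is repeated. *)
Lemma occurs_close (s0 x : nat) (s q u : seq nat) : x \notin q -> x \notin u ->
  (forall c, c \in s0 :: s -> 1 < count_mem c (s0 :: s)) ->
  occurs (s0 :: s) (x :: q ++ x :: u) ->
  occurs (s0 :: s) (q ++ u) \/
  exists g, [/\ {in s0 :: s &, injective g}, g s0 = x & subseq (map g s) (q ++ x :: u)].
Proof.
move=> xq xu dbl [g inj /=]; case: eqP => [gx sub|_ sub]; first by right; exists g.
rewrite -map_cons in sub.
left; exists g => //; apply: (subseq_del _ sub); apply/negP => /mapP [c cs xE].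
have := leq_count_subseq (pred1 x) sub.
have := leq_count_map g c (s0 :: s); rewrite -xE count_cat (count_mem_cons x x) eqxx.
by have := dbl c cs; move: xq xu; rewrite -!count_gt0; lia.
Qed.

(* The oldest open edge [x] crosses every queued edge and nests none, so a pattern using it would
   need the queue to be closed out of order. *)
Lemma avoiding_close k (x : nat) (sigma q u : seq nat) : is_matching k sigma -> 0 < k ->
  uniq q -> x \notin q -> x \notin u ->
  subseq q u -> {in q, forall c, count_mem c u = 1} ->
  avoiding sigma (q ++ u) -> avoiding sigma (x :: q ++ x :: u).
Proof.
move=> /matchingP blk k_gt0 uq xq xu qu cq [av1 av2 av3].
have cnt1 c : count_mem c q <= 1 by rewrite count_uniq_mem // leq_b1.
have neq g s0 s c : {in s0 :: s &, injective g} -> g s0 = x -> c \in s -> c != s0 -> g c != x.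
  move=> inj <- cs; apply: contraNneq => /inj -> //; rewrite ?mem_head //.
  by rewrite inE cs orbT.
split.
- move/(occurs_close xq xu); case=> //.
    move=> c; rewrite -/(lifting sigma) mem_lifting /lifting count_mem_cons.
    rewrite -cats1 count_cat count_mem_cons => /orP [/eqP ->|]; first by rewrite eqxx; lia.
    case/mapP => d ds ->; rewrite count_map.
    have -> : count (preim S (pred1 d.+1)) sigma = count_mem d sigma by apply: eq_count.
    by case: (blk) => _ ->; rewrite -(block_mem d blk) ds; lia.
  case=> g [inj gx]; rewrite map_rcons gx -cats1 => /(subseq_split xq xu) [sub _].
  (* The copy of [sigma] would lie in [q], between the two ends of [x], but 1 occurs twice in
     [sigma] and [q] has no repeated letter. *)
  have s1 : 1 \in sigma by rewrite (block_mem _ blk); lia.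
  have := leq_count_subseq (pred1 (g 2)) sub.
  rewrite -map_comp; have := leq_count_map (g \o S) 1 sigma.
  have -> : count_mem 1 sigma = 2 by case: blk => _ ->; rewrite add0n k_gt0.
  by rewrite [(g \o S) 1]/=; have := cnt1 (g 2); lia.
- move/(occurs_close xq xu); case=> //.
    by apply/allP; vm_compute.
  case=> g [inj gx] /=; rewrite gx.
  move/(@subseq_split x [:: g 2; g 3] [:: g 3; g 2] _ _ xq xu) => [s1 s2].
  have g23 : g 2 != g 3 by apply/eqP => /(inj 2 3 isT isT).
  have [c2 c3] : count_mem (g 2) u = 1 /\ count_mem (g 3) u = 1.
    by split; apply: cq; apply: (mem_subseq s1); rewrite !inE eqxx ?orbT.
  by apply: (subseq_pair_anti g23 c2) (subseq_trans s1 qu) s2; rewrite c3.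
move/(occurs_close xq xu); case=> //.
  by apply/allP; vm_compute.
case=> g [inj gx] /=; rewrite gx.
move/(@subseq_split x [:: g 2; g 3; g 2] [:: g 3] _ _ xq xu) => [s1 s2].
have := leq_count_subseq (pred1 (g 2)) s1; have := cnt1 (g 2).
rewrite !count_mem_cons eqxx; lia.
Qed.

(** No proper nonempty factor is closed under the edges. When a word on fresh letters is inserted
    somewhere, an occurrence of a solid pattern lies wholly inside or wholly outside it. *)
Definition solid (s : seq nat) := forall s1 s2 s3, s = s1 ++ s2 ++ s3 ->
  (forall c, c \in s2 -> c \notin s1 ++ s3) -> s2 = [::] \/ s2 = s.

(** A finite test over the start and the length of the factor, so that solidity of the two fixed
    patterns is settled by computation. *)
Lemma solid_check (s : seq nat) :
  all (fun i => all (fun j => let s2 := take j (drop i s) in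
     [|| nilp s2, has (mem (take i s ++ drop j (drop i s))) s2 | s2 == s])
     (iota 0 (size s).+1)) (iota 0 (size s).+1) -> solid s.
Proof.
move=> /allP H s1 s2 s3 E dis.
have /H /allP /(_ (size s2)) : size s1 \in iota 0 (size s).+1.
  by rewrite mem_iota ltnS E size_cat /= leq_addr.
have -> : size s2 \in iota 0 (size s).+1.
  by rewrite mem_iota ltnS E !size_cat addnCA /= leq_addr.
move=> /(_ isT) /=.
have -> : drop (size s1) s = s2 ++ s3 by rewrite E drop_size_cat.
have -> : take (size s1) s = s1 by rewrite E take_size_cat.
rewrite take_size_cat // drop_size_cat //.
case/or3P => [/nilP ->|/hasP [c cs2]|/eqP]; [by left| |by right].
by rewrite /= (negPf (dis c cs2)).
Qed.

Lemma solid_chi : solid chi. Proof. exact: solid_check. Qed.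
Lemma solid_chibar : solid chibar. Proof. exact: solid_check. Qed.

Lemma subseq_map_insert g (s q f u : seq nat) :
  subseq (map g s) (q ++ f ++ u) -> (forall c, c \in f -> c \notin q ++ u) ->
  exists s1 s2 s3, [/\ s = s1 ++ s2 ++ s3, forall c, c \in s2 -> c \notin s1 ++ s3,
    subseq (map g s1) q, subseq (map g s2) f & subseq (map g s3) u].
Proof.
case/subseq_cat_inv => t1 [t' [E sub1 /subseq_cat_inv [t2 [t3 [E' sub2 sub3]]]]] dis.
rewrite {t'}E' in E.
have [s1 [s2 [s3 [Es E1 E2 E3]]]] : exists s1 s2 s3,
    [/\ s = s1 ++ s2 ++ s3, map g s1 = t1, map g s2 = t2 & map g s3 = t3].
  exists (take (size t1) s), (take (size t2) (drop (size t1) s)), (drop (size t2) (drop (size t1) s)).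
  rewrite !cat_take_drop !map_take !map_drop E drop_size_cat // !take_size_cat //.
  by rewrite drop_size_cat.
exists s1, s2, s3; rewrite E1 E2 E3; split=> // c cs2; apply/negP; rewrite mem_cat => c13.
have /(mem_subseq sub2)/dis : g c \in t2 by rewrite -E2 map_f.
rewrite mem_cat negb_or => /andP [/negP nq /negP nu].
case/orP: c13 => /(map_f g); rewrite ?E1 ?E3 => H.
  by apply: nq; apply: (mem_subseq sub1).
by apply: nu; apply: (mem_subseq sub3).
Qed.

Lemma solid_insert (s q f u : seq nat) : solid s -> (forall c, c \in f -> c \notin q ++ u) ->
  occurs s (q ++ f ++ u) -> occurs s (q ++ u) \/ occurs s f.
Proof.
move=> sol dis [g inj /subseq_map_insert /(_ dis) [s1 [s2 [s3 [E d2 u1 u2 u3]]]]].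
case: (sol _ _ _ E d2) => E2; [left|right]; exists g => //; last by rewrite -E2.
by rewrite E E2 map_cat cat_subseq.
Qed.

(** Two factors without a common letter are both blocks, the second one shifted by the order of the
    first, so they would form a juxtaposition. *)
Lemma connected_split k (sigma a b : seq nat) : is_matching k sigma -> connected k sigma ->
  sigma = a ++ b -> (forall c, c \in a -> c \notin b) -> a = [::] \/ b = [::].
Proof.
move=> /matchingP [can cnt] [_ conn] E dis.
case: (eqVneq a [::]) => [->|a0]; [by left | right]; apply/eqP/negPn/negP => b0.
rewrite E canon_cat in can; case/andP: can => cana canb.
have cpos c : c \in sigma -> 0 < c /\ count_mem c sigma = 2.
  by rewrite -count_gt0 cnt; case: ifP => // /andP [].
have blka : block 0 (top 0 a) a.
  rewrite -[X in block _ X _]subn0; apply: block_intro => // c ca.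
  have [|c0] := cpos c; first by rewrite E mem_cat ca.
  by rewrite E count_cat (count_memPn (dis _ ca)) addn0.
have blkb : block (top 0 a) (top (top 0 a) b - top 0 a) b.
  apply: block_intro => // c cb.
  have ca : c \notin a by apply/negP => /dis; rewrite cb.
  have [|c0] := cpos c; first by rewrite E mem_cat cb orbT.
  rewrite E count_cat (count_memPn ca) add0n; split=> //.
  by rewrite ltnNge -(canon_mem cana c0).
have [b' Eb blkb'] := block_unshift blkb.
apply: conn; exists (top 0 a), (top (top 0 a) b - top 0 a), a, b'.
have pos m n w : w != [::] -> block m n w -> 0 < n.
  by move=> w0 /block_size; case: n => //; case: w w0.
split; rewrite /juxt -?Eb //; try exact/matchingP.
- exact: pos blka.
- exact: pos blkb.
Qed.

(** The patterns [chi] and [chibar] are solid. The lifting is not: its outer edge may surround [f],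
    and then connectedness of [sigma] forces a whole copy of [sigma] into [f]. *)
Lemma avoiding_insert k (sigma q f u : seq nat) : is_matching k sigma -> connected k sigma ->
  subseq q u -> {in q, forall c, count_mem c u = 1} ->
  (forall c, c \in f -> c \notin q ++ u) ->
  ~ occurs sigma f -> ~ occurs chi f -> ~ occurs chibar f ->
  avoiding sigma (q ++ u) -> avoiding sigma (q ++ f ++ u).
Proof.
move=> mat conn qu cq dis f1 f2 f3 [av1 av2 av3]; split; first last.
- by case/(solid_insert solid_chibar dis).
- by case/(solid_insert solid_chi dis).
case=> g inj /subseq_map_insert /(_ dis) [s1 [s2 [s3 [E d2 u1 u2 u3]]]].
have s20 : s2 != [::].
  apply/eqP => s20; apply: av1; exists g => //.
  by rewrite E s20 map_cat cat_subseq.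
(* If no edge of [sigma] straddled [f], [sigma] would not be connected.  A straddling edge and the
   outer edge of the lifting both lie in [q] and are nested, against the closing order of [q]. *)
case: s1 E d2 u1 => [|x a] E d2 u1.
  case/lastP: s3 E d2 u3 => [|b y] E d2 u3.
    apply/f1/occurs_of_lifting; exists g => //; by rewrite E cats0.
  case: s2 s20 E d2 u2 => // x s2 _ [Ex] /(congr1 (last 0)).
  rewrite last_rcons last_cat last_rcons => Ey /(_ x (mem_head _ _)).
  by rewrite -Ex Ey mem_rcons mem_head.
case/lastP: s3 E d2 u3 => [|b y] E d2 u3.
  case/lastP: s2 s20 E d2 u2 => // s2 y _ [Ex] /(congr1 (last 0)).
  rewrite last_rcons cats0 last_cat last_rcons => Ey /(_ y).
  by rewrite -Ex -Ey mem_rcons !mem_head => /(_ isT).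
case: E => Ex; rewrite -!rcons_cat => /rcons_inj [E Ey]; subst x y.
have [/hasP [c ca cb]|/hasPn nab] := boolP (has (mem b) a).
  have c1 : 1 != c.
    have : c \in map S sigma by rewrite E mem_cat ca.
    case/mapP => d ds ->; move/matchingP: mat ds => /block_mem ->; lia.
  have g1c : g 1 != g c.
    apply: contraNneq c1 => /inj -> //; rewrite mem_lifting // E !mem_cat ca orbT //.
  have m1 : g 1 \in q by apply: (mem_subseq u1); rewrite mem_head.
  have mc : g c \in q by apply: (mem_subseq u1); rewrite inE map_f ?orbT.
  apply: (@subseq_pair_anti (g 1) (g c) u g1c (cq _ m1)).
  - by rewrite (cq _ mc).
  - apply: subseq_trans qu; apply: subseq_trans u1.
    by rewrite /= eqxx sub1seq map_f.
  apply: subseq_trans u3; rewrite map_rcons -cats1.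
  by apply: (@cat_subseq _ [:: g c] [:: g 1]); rewrite sub1seq ?mem_head //; apply: map_f.
have Es : sigma = map predn a ++ map predn s2 ++ map predn b.
  by rewrite -!map_cat -E -map_comp -[LHS]map_id; apply: eq_map.
have pos c : c \in a ++ s2 ++ b -> c = c.-1.+1 by rewrite -E => /mapP [d _ ->].
have predI w w' : {subset w <= a ++ s2 ++ b} -> {subset w' <= a ++ s2 ++ b} ->
    (forall c, c \in w -> c \notin w') ->
    forall c, c \in map predn w -> c \notin map predn w'.
  move=> sw sw' dw c /mapP [d dd ->]; apply/negP => /mapP [e ew'] de.
  by case/negP: (dw d dd); rewrite (pos d (sw d dd)) de -(pos e (sw' e ew')).
have d2' c : c \in s2 -> c \notin a /\ c \notin b.
  by move/d2; rewrite mem_cat inE mem_rcons inE !negb_or => /andP [/andP [_ ->] /andP [_ ->]].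
have s20' : map predn s2 <> [::] by case: (s2) s20.
(* With no straddling edge, connectedness is applied twice: first to [a] against [s2 ++ b], then to
   [s2] against [b]. As [s2] is nonempty, both [a] and [b] vanish and [sigma] occurs in [f]. *)
have a0 : map predn a = [::].
  case: (connected_split mat conn Es) => //; last by case: (map predn s2) s20'.
  rewrite -map_cat; apply: predI => [c ca|c ca|c ca]; rewrite ?mem_cat ?ca ?orbT //.
    by move: ca; rewrite mem_cat => /orP [->|->]; rewrite ?orbT.
  rewrite negb_or nab // andbT; apply/negP => /d2' [] /negP; exact.
have b0 : map predn b = [::].
  rewrite a0 /= in Es; case: (connected_split mat conn Es) => //.
  apply: predI => [c ca|c ca|c /d2' [] //]; rewrite !mem_cat ca ?orbT //.
apply: f1; rewrite Es a0 b0 cats0 /=; exists (g \o S) => [c d /mapP [c' cs ->] /mapP [d' ds ->]|].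
  have sS e : e \in s2 -> e \in a ++ s2 ++ b by rewrite !mem_cat => ->; rewrite orbT.
  rewrite /= -(pos c') ?sS // -(pos d') ?sS // => /inj Ecd; congr predn.
  by apply: Ecd; rewrite mem_lifting E sS ?orbT.
rewrite -map_comp (@eq_in_map _ _ _ g s2).1 // => c cs /=.
by rewrite -pos // !mem_cat cs orbT.
Qed.

(** * Left-to-right decomposition *)

Definition mlist (S : seq (seq nat)) (n : nat) : seq (seq nat) :=
  [seq map val (t : (n.*2).-tuple 'I_n.+1) | t <- enum [set t : (n.*2).-tuple 'I_n.+1 |
      is_matching n (map val t) && all (avoids (map val t)) S]].

Lemma size_mlist S n : size (mlist S n) = Mcount S n.
Proof. by rewrite size_map -cardE. Qed.

Lemma uniq_mlist S n : uniq (mlist S n).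
Proof.
rewrite map_inj_uniq ?enum_uniq // => t t' /(inj_map val_inj).
exact: val_inj.
Qed.

Lemma mem_mlist S n w : (w \in mlist S n) = is_matching n w && all (avoids w) S.
Proof.
apply/mapP/idP => [[t]|H]; first by rewrite mem_enum inE => + ->.
have blk : block 0 n w by apply/matchingP; case/andP: H.
have sz : size (map (@inord n) w) == n.*2 by rewrite size_map (block_size blk).
have E : w = map val (Tuple sz).
  rewrite /= -map_comp -[LHS]map_id; apply/eq_in_map => x.
  by rewrite (block_mem _ blk) /= => xn; rewrite inordK //; lia.
by exists (Tuple sz) => //; rewrite mem_enum inE -E.
Qed.

Lemma mlist_lifting sigma n w : reflect (block 0 n w /\ avoiding sigma w)
  (w \in mlist [:: lifting sigma; chi; chibar] n).
Proof.
rewrite mem_mlist /= andbT; apply: (iffP and4P) => [[/matchingP blk]|[/matchingP -> [a b c]]].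
  by move=> /containsP a /containsP b /containsP c.
by split=> //; apply/containsP.
Qed.

Lemma mlist_sigma sigma n w :
  reflect [/\ block 0 n w, ~ occurs sigma w, ~ occurs chi w & ~ occurs chibar w]
  (w \in mlist [:: sigma; chi; chibar] n).
Proof.
rewrite mem_mlist /= andbT; apply: (iffP and4P) => [[/matchingP blk]|[/matchingP -> a b c]].
  by move=> /containsP a /containsP b /containsP c.
by split=> //; apply/containsP.
Qed.

(* [q] lists, in order of opening, the edges opened but not closed before [u]; [m] is the last
   letter used before [u], and [n] edges open in [u].  FIFO closing is [subseq q u]. *)
Definition pregood (sigma q : seq nat) (m n : nat) (u : seq nat) : Prop :=
  [/\ forall c, count_mem c u = if c \in q then 1 else if m < c <= m + n then 2 else 0,
      canon m u, subseq q u & avoiding sigma (q ++ u)].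

(* The first letter of [u] belongs to an edge that is not nested in another one. *)
Definition good (sigma q : seq nat) (m n : nat) (u : seq nat) : Prop :=
  pregood sigma q m n u /\
  (if u is x :: u' then (x \in q) || subseq (rcons q x) u' else true).

Definition queue (q : seq nat) (m : nat) : bool := uniq q && all (leq^~ m) q.

Lemma queue_leq q m c : queue q m -> c \in q -> c <= m.
Proof. by case/andP => _ /allP H /H. Qed.

Lemma queue_rcons q m : queue q m -> queue (rcons q m.+1) m.+1.
Proof.
move=> qm; case/andP: (qm) => uq le; rewrite /queue rcons_uniq uq all_rcons leqnn /= andbT.
apply/andP; split; first by apply/negP => /(queue_leq qm); rewrite ltnn.
by apply: sub_all le => x; apply: leqW.
Qed.

Lemma queue_leq_trans q m m' : m <= m' -> queue q m -> queue q m'.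
Proof.
move=> le /andP [uq al]; rewrite /queue uq /=; apply: sub_all al => x lex.
exact: leq_trans lex le.
Qed.

Lemma good_nil sigma q m n : good sigma q m n [::] -> q = [::] /\ n = 0.
Proof.
case=> -[cnt _ /eqP q0 _] _; split=> //; have := cnt m.+1; rewrite q0 /=.
by case: n {cnt} => // n; rewrite ltnSn addnS ltnS leq_addr.
Qed.

Lemma good_nil0 sigma m : 0 < size sigma -> good sigma [::] m 0 [::].
Proof.
move=> s0; split=> //; split=> //; first by move=> c /=; case: ifP => //; lia.
by split=> -[g _]; rewrite subseq0.
Qed.

(** With no open edge, the first letter cannot be nested in anything. *)
Lemma pregood_nil sigma m n u : pregood sigma [::] m n u -> good sigma [::] m n u.
Proof.
move=> pg; split=> //; case: u pg => // x u [/(_ x) + _ _ _].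
rewrite count_mem_cons eqxx in_nil sub1seq -count_gt0; case: ifP => _; lia.
Qed.

(** A closing letter must be the head of [q]: otherwise all of [q] would be a subsequence of [u],
    and [x] would occur once more there. An opening letter is [m.+1] by canonicity, and joins the
    end of the queue because its edge is outer. *)
Lemma good_cons sigma q m n x u : queue q m -> good sigma q m n (x :: u) ->
  (exists2 q', q = x :: q' & pregood sigma q' m n u) \/
  [/\ x = m.+1, 0 < n & pregood sigma (rcons q m.+1) m.+1 n.-1 u].
Proof.
move=> qm [[cnt can sub av] /=]; have := cnt x; rewrite count_mem_cons eqxx.
case/andP: can => xm can.
case: ifP => [xq cx _|xq cx /= subx]; [left|right].
  case: q qm cnt sub av xq => // z q qm cnt sub av xq.
  have zx : z = x.
    apply/eqP; move: sub => /=; case: eqP => // /eqP zx /mem_subseq /(_ x xq).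
    by rewrite -count_gt0; lia.
  subst z; exists q => //; case/andP: (qm) => /= /andP [xnq _] _; split.
  - move=> c; have := cnt c; rewrite count_mem_cons inE (eq_sym c).
    case: (eqVneq x c) => [<-|_] //=.
    have := queue_leq qm (mem_head _ _); rewrite (negPf xnq); case: ifP; lia.
  - by rewrite (maxn_idPl (queue_leq qm (mem_head _ _))) in can.
  - by move: sub; rewrite /= eqxx.
  apply: avoiding_subseq av _; rewrite /= ; apply: subseq_trans (subseq_cons _ x).
  by apply: cat_subseq => //; apply: subseq_cons.
have xE : x = m.+1 by move: cx; case: ifP; lia.
have n0 : 0 < n by move: cx; case: ifP; lia.
rewrite xE in can subx cnt av xq *; split=> //; split=> //.
- move=> c; have := cnt c; rewrite count_mem_cons mem_rcons inE (eq_sym c).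
  case: (eqVneq m.+1 c) => [<-|neq] /=; first by rewrite xq; case: ifP; lia.
  by case: (c \in q) => //; do 2![case: ifP]; lia.
- by rewrite (maxn_idPr (leqnSn m)) in can.
by rewrite cat_rcons.
Qed.

Lemma good_close k sigma q m n x u : is_matching k sigma -> 0 < k -> queue (x :: q) m ->
  pregood sigma q m n u -> good sigma (x :: q) m n (x :: u).
Proof.
move=> mat k0 qm [cnt can sub av]; split; last by rewrite mem_head.
have xm := queue_leq qm (mem_head _ _).
case/andP: (qm) => /= /andP [xq uq] _.
have xu : x \notin u by rewrite -count_gt0 cnt (negPf xq); case: ifP => //; lia.
split; rewrite /= ?eqxx //; last first.
- apply: (avoiding_close mat k0) => // c cq; by rewrite cnt cq.
- by rewrite (leqW xm) (maxn_idPl xm).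
move=> c; have := cnt c; rewrite inE (eq_sym c).
case: (eqVneq x c) => [<-|_] //=; by rewrite (count_memPn xu).
Qed.

Lemma good_open sigma q m n u : queue q m ->
  pregood sigma (rcons q m.+1) m.+1 n u -> good sigma q m n.+1 (m.+1 :: u).
Proof.
move=> qm [cnt can sub av]; split; last by rewrite sub orbT.
have mq : m.+1 \notin q by apply/negP => /(queue_leq qm); rewrite ltnn.
split; last by rewrite -cat_rcons.
- move=> c; have := cnt c; rewrite count_mem_cons mem_rcons inE (eq_sym c).
  case: (eqVneq m.+1 c) => [<-|neq] /=; first by rewrite (negPf mq); case: ifP; lia.
  by case: (c \in q) => //; do 2![case: ifP]; lia.
- by rewrite /= leqnn (maxn_idPr (leqnSn m)).
by apply: subseq_trans (subseq_cons _ _); apply: subseq_trans sub; apply: subseq_rcons.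
Qed.

Lemma pregood_fill k sigma q m n j f u : is_matching k sigma -> connected k sigma ->
  queue q m -> j <= n -> block m j f ->
  ~ occurs sigma f -> ~ occurs chi f -> ~ occurs chibar f ->
  good sigma q (m + j) (n - j) u -> pregood sigma q m n (f ++ u).
Proof.
move=> mat conn qm jn blk f1 f2 f3 [[cnt can sub av] _]; case: (blk) => canf cntf; split.
- move=> c; rewrite count_cat cntf cnt.
  case: (boolP (c \in q)) => [/(queue_leq qm)|_]; last by do 3![case: ifP]; lia.
  by case: ifP; lia.
- by rewrite canon_cat canf (block_top blk).
- exact: subseq_trans sub (suffix_subseq _ _).
apply: (avoiding_insert mat conn) => // [c cq|c]; first by rewrite cnt cq.
rewrite (block_mem _ blk) mem_cat negb_or => cm.
have cq : c \notin q by apply/negP => /(queue_leq qm); lia.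
by rewrite cq -count_gt0 cnt (negPf cq); case: ifP; lia.
Qed.

(** The gap filling [f] is the longest prefix of edges nested in the newest open edge [z]. It is
    closed under its edges because [chi] and [chibar] are avoided, and it avoids [sigma] because [z]
    encloses it. *)
Lemma pregood_split k sigma q z m n u : is_matching k sigma ->
  queue (rcons q z) m -> pregood sigma (rcons q z) m n u ->
  exists j f u', [/\ u = f ++ u', j <= n, block m j f,
    [/\ ~ occurs sigma f, ~ occurs chi f & ~ occurs chibar f] &
    good sigma (rcons q z) (m + j) (n - j) u'].
Proof.
set Q := rcons q z => /matchingP mat qm [cnt can sub av].
have zQ : z \in Q by rewrite mem_rcons mem_head.
have zu : z \in u by rewrite -count_gt0 cnt zQ.
case/splitPr: zu cnt can sub av => al be cnt can sub av.
have [za zb] : z \notin al /\ z \notin be.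
  have := cnt z; rewrite zQ count_cat count_mem_cons eqxx -!count_gt0; lia.
(* A letter is bad when its edge is not nested in [z], whose closer comes right after [al]; [f]
   stops at the first bad letter. *)
pose bad d := (d \in Q) || (count_mem d al != 2).
pose i := find bad al; pose f := take i al; pose r := drop i al.
have alE : al = f ++ r by rewrite cat_take_drop.
have fP c : c \in f -> c \notin Q /\ count_mem c al = 2.
  move=> cf; have : ~~ bad c.
    have cf' : index c al < i by rewrite -in_take ?(mem_take cf).
    by have := before_find 0 cf'; rewrite nth_index ?(mem_take cf) // => ->.
  by rewrite negb_or negbK => /andP [-> /eqP].
have cnt2 c : c \notin Q -> c \in al ++ z :: be -> m < c <= m + n /\ count_mem c (al ++ z :: be) = 2.
  by move=> cQ; rewrite -count_gt0 cnt (negPf cQ); case: ifP.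
have rP d r' : r = d :: r' -> d \in Q \/
    [/\ d \notin Q, d \notin f & d \in be].
  move=> rE; have hasb : has bad al.
    by rewrite has_find -/i ltnNge; apply/negP => /drop_oversize; rewrite -/r rE.
  have bd : bad d.
    have := nth_find 0 hasb; rewrite -/i; have := drop_nth 0 (_ : i < size al).
    by rewrite -has_find => /(_ hasb); rewrite -/r rE => -[<-].
  case: (boolP (d \in Q)) => dQ; [by left | right].
  have df : d \notin f by apply/negP => /fP [_ c2]; move: bd; rewrite /bad (negPf dQ) c2.
  have dal : d \in al by rewrite alE rE mem_cat mem_head orbT.
  split=> //; have [|_] := cnt2 d dQ; first by rewrite mem_cat dal.
  rewrite count_cat count_mem_cons.
  have zd : (z == d) = false by apply: contraNF za => /eqP ->.
  rewrite zd -count_gt0 => c2; move: bd; rewrite /bad (negPf dQ) orFb.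
  by move: dal; rewrite -count_gt0; lia.
(* An edge [c] leaving [f] would cross the edge of the first bad letter [d]. If [d] is in the queue,
   the letters [d z c d c z] form [chi]; otherwise [z c d c z d] form [chibar]. *)
have fr c : c \in f -> c \notin r.
  move=> cf; have [cQ c2] := fP c cf; apply/negP => cr.
  have zc : z != c by apply: contraNneq cQ => <-.
  case rE : r (rP) => [|d r'] //; first by rewrite rE in cr.
  move=> /(_ d r' erefl) dP.
  have cr' : c \in r'.
    move: cr; rewrite rE inE => /orP [/eqP cd|//]; subst c.
    by case: dP => [|[]]; rewrite ?(negPf cQ) ?cf.
  have dz : d != z.
    by apply: contraNneq za => <-; rewrite alE rE mem_cat mem_head orbT.
  have subu s t : subseq s r' -> subseq t be ->
      subseq ([:: c; d] ++ s ++ z :: t) ((f ++ d :: r') ++ z :: be).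
    move=> ss tt; rewrite -catA; apply: (@cat_subseq _ [:: c]); first by rewrite sub1seq.
    by rewrite /= eqxx; apply: cat_subseq => //=; rewrite eqxx.
  have sc : subseq [:: c] r' by rewrite sub1seq.
  rewrite alE rE in av.
  case: dP => [dQ|[dQ df db]].
    have dq : d \in q by move: dQ; rewrite mem_rcons inE (negPf dz).
    case: av => _ + _; apply; apply: (@occurs_chi d z c).
      rewrite /= !inE negb_or dz zc !andbT /=.
      by apply: contraNneq cQ => <-.
    apply: (@cat_subseq _ [:: d; z] [:: c; d; c; z]).
      by rewrite /Q -cats1; apply: (@cat_subseq _ [:: d] [:: z]); rewrite sub1seq // mem_head.
    exact: (subu [:: c] [::] sc (sub0seq _)).
  case: av => _ _; apply; apply: (@occurs_chibar z c d).
    rewrite /= !inE negb_or zc eq_sym dz !andbT /=.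
    by apply: contraNneq df => <-.
  apply: (@cat_subseq _ [:: z] [:: c; d; c; z; d]); first by rewrite sub1seq.
  by apply: (subu [:: c] [:: d] sc); rewrite sub1seq.
have fbe c : c \in f -> c \notin z :: be.
  move=> cf; have [cQ c2] := fP c cf.
  have [|_] := cnt2 c cQ; first by rewrite mem_cat alE mem_cat cf.
  rewrite count_cat c2 -count_gt0; lia.
have fu c : c \in f -> c \notin r ++ z :: be.
  by move=> cf; rewrite mem_cat negb_or fr ?fbe.
have cntf c : c \in f -> count_mem c f = 2.
  move=> cf; have [_ <-] := fP c cf.
  by rewrite alE count_cat (count_memPn (fr c cf)) addn0.
have fm c : c \in f -> m < c <= m + n.
  move=> cf; have [cQ _] := fP c cf.
  by have [] := cnt2 c cQ; rewrite // mem_cat alE mem_cat cf.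
have uE : al ++ z :: be = f ++ (r ++ z :: be) by rewrite alE catA.
rewrite uE in can cnt sub av *; rewrite canon_cat in can; case/andP: can => canf canr.
have blk : block m (top m f - m) f.
  by apply: block_intro => // c cf; rewrite cntf //; case/andP: (fm c cf).
set j := top m f - m in blk *.
have jn : j <= n.
  rewrite leqNgt; apply/negP => lt; have := fm (m + j); rewrite (block_mem _ blk); lia.
have subfQ : subseq (z :: rcons f z) (Q ++ f ++ r ++ z :: be).
  rewrite -cats1; apply: (@cat_subseq _ [:: z] (f ++ [:: z])); first by rewrite sub1seq.
  by apply: cat_subseq => //; rewrite sub1seq mem_cat mem_head orbT.
have ff : subseq f (Q ++ f ++ r ++ z :: be).
  by apply: subseq_trans (suffix_subseq _ _); apply: prefix_subseq.
have zf : z \notin f by apply/negP => /fbe; rewrite mem_head.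
have subr : subseq Q (r ++ z :: be).
  by apply: subseq_skip sub => c cQ; apply/negP => /fP []; rewrite cQ.
exists j, f, (r ++ z :: be); split=> //.
  case: (av) => a1 a2 a3; split=> oc; [apply: a1 | apply: a2 | apply: a3].
  - apply: occurs_subseq subfQ; apply: occurs_lifting => //.
    by rewrite (block_mem _ mat).
  - exact: occurs_subseq ff.
  - exact: occurs_subseq ff.
split; first split=> //.
- move=> c; case: (boolP (c \in f)) => cf.
    rewrite (count_memPn (fu c cf)); have [/negPf -> _] := fP c cf.
    by rewrite (block_mem _ blk) in cf; case: ifP => //; lia.
  have := cnt c; rewrite count_cat (count_memPn cf) add0n => ->.
  case: (c \in Q) => //; rewrite (block_mem _ blk) in cf.
  by do 2![case: ifP]; lia.
- by rewrite -(block_top blk).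
- apply: avoiding_subseq av _; apply: cat_subseq => //; exact: suffix_subseq.
(* The remainder starts with a closer from the queue, namely [z] if [r] is empty, or with an edge
   [d] that closes after [z] and hence after the whole queue. *)
case rE : r (rP) => [|d r'] /=; first by rewrite zQ.
move=> /(_ d r' erefl) [-> //|[dQ df db]]; rewrite (negPf dQ) /=.
have qr : subseq q r'.
  have zr : z \notin r by apply: contra za; rewrite alE mem_cat => ->; rewrite orbT.
  move: subr; rewrite /Q -cats1 => /(subseq_split zr zb) [+ _].
  rewrite rE -cat1s; apply: subseq_skip => c cq; rewrite inE.
  by apply: contraNneq dQ => <-; rewrite mem_rcons inE cq orbT.
rewrite /Q -!cats1 -catA; apply: cat_subseq => //=; rewrite eqxx sub1seq //.
Qed.

(** If [f1] were shorter, the next letter [y] would belong to [f2], and [good] would make it an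
    outer edge closing after the last edge of [q]. That edge closes beyond [f2], so [y] would also
    occur in [u2], which its count there forbids. *)
Lemma good_prefix_inj sigma q m n j1 j2 f1 f2 u1 u2 : q != [::] -> queue q m ->
  block m j1 f1 -> block m j2 f2 ->
  good sigma q (m + j1) (n - j1) u1 -> good sigma q (m + j2) (n - j2) u2 ->
  f1 ++ u1 = f2 ++ u2 -> f1 = f2.
Proof.
move=> q0 qm; wlog le : j1 j2 f1 f2 u1 u2 / size f1 <= size f2.
  move=> H b1 b2 g1 g2 E; case/orP: (leq_total (size f1) (size f2)) => le.
    exact: (H j1 j2 f1 f2 u1 u2).
  by apply/esym/(H j2 j1 f2 f1 u2 u1).
move=> b1 b2 [_ hd] [[cnt2 _ _ _] _] E.
have E2 : f2 = f1 ++ drop (size f1) f2.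
  rewrite -{1}(cat_take_drop (size f1) f2); congr (_ ++ _).
  move/(congr1 (take (size f1))): E; by rewrite take_size_cat // takel_cat.
case: (drop _ _) E2 => [|y r] E2; first by rewrite E2 cats0.
move: E hd; rewrite {1}E2 -catA => /eqP; rewrite eqseq_cat // eqxx /= => /eqP -> /=.
have yf : y \in f2 by rewrite E2 mem_cat mem_head orbT.
have ym : m < y <= m + j2 by rewrite -(block_mem _ b2).
have yq : (y \in q) = false by apply/negP => /(queue_leq qm); lia.
rewrite yq /=; case/lastP: q q0 qm cnt2 yq => // q z _ qm cnt2 yq.
have zq : z \in rcons q z by rewrite mem_rcons mem_head.
have zr : z \notin r.
  have zm := queue_leq qm zq; apply/negP => zr.
  have : z \in f2 by rewrite E2 mem_cat inE zr !orbT.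
  rewrite (block_mem _ b2); lia.
rewrite -!cats1 -catA => /(subseq_trans (suffix_subseq _ _)).
case/subseq_cat_inv => t1 [t2 [Et s1 s2]].
have yu : y \in u2.
  apply: (mem_subseq s2); case: t1 Et s1 => [|a t1] /=; first by move <-; rewrite !inE eqxx orbT.
  by case=> <- _ /mem_subseq /(_ z (mem_head _ _)); rewrite (negPf zr).
by move: yu; rewrite -count_gt0 cnt2 yq; case: ifP; lia.
Qed.

(** * Explicit lists of fillings and suffixes *)

Definition fillings (sigma : seq nat) (m n : nat) : seq (seq nat) :=
  [seq map (addn m) f | j <- iota 0 n.+1, f <- mlist [:: sigma; chi; chibar] j].

Definition fill (sigma : seq nat) (g : nat -> nat -> seq (seq nat)) (m n : nat) :=
  [seq f ++ u | f <- fillings sigma m n, u <- g (m + (size f)./2) (n - (size f)./2)].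

(** When no edge is open there is no gap to fill: the next edge is itself outer. *)
Definition fill_queue (sigma : seq nat) (g : seq nat -> nat -> nat -> seq (seq nat))
    (q : seq nat) (m n : nat) :=
  if q is [::] then g q m n else fill sigma (g q) m n.

(* The list of all [u] with [good sigma q m n u], provided [n.*2 + size q < k]. *)
Fixpoint suffixes (sigma : seq nat) (k : nat) (q : seq nat) (m n : nat) :=
  if k is k'.+1 then
    (if q is x :: q' then map (cons x) (fill_queue sigma (suffixes sigma k') q' m n)
     else if n is 0 then [:: [::]] else [::]) ++
    (if n is n'.+1 then
       map (cons m.+1) (fill_queue sigma (suffixes sigma k') (rcons q m.+1) m.+1 n')
     else [::])
  else [::].

Lemma mem_fillings sigma m n f :
  f \in fillings sigma m n <->
  exists2 j, j <= n &
    block m j f /\ [/\ ~ occurs sigma f, ~ occurs chi f & ~ occurs chibar f].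
Proof.
have shift_inj : injective (addn m) by exact: addnI.
split.
  case/allpairsPdep => j [w [jn /mlist_sigma [blk a b c] ->]].
  exists j; first by rewrite mem_iota in jn; lia.
  split; first by apply/block_shift.
  by split=> /occurs_map H; [apply: a|apply: b|apply: c]; apply: H => ? ? _ _ /addnI.
case=> j jn [blk [a b c]]; have [w fE blkw] := block_unshift blk.
apply/allpairsPdep; exists j, w; split=> //; first by rewrite mem_iota; lia.
by apply/mlist_sigma; split=> // /occurs_map_inv /(_ shift_inj); rewrite -fE.
Qed.

Lemma uniq_fillings sigma m n : uniq (fillings sigma m n).
Proof.
apply: allpairs_uniq_dep => [|j _|p1 p2]; [exact: iota_uniq | exact: uniq_mlist |].
case/allpairsPdep => j1 [w1 [_ m1 ->]] /allpairsPdep [j2 [w2 [_ m2 ->]]] /= E.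
have Ew : w1 = w2 by apply: inj_map E; apply: addnI.
subst w2; case/mlist_sigma: m1 => /block_size s1 _ _ _.
case/mlist_sigma: m2 => /block_size s2 _ _ _.
by have -> : j1 = j2 by lia.
Qed.

Lemma size_half m j f : block m j f -> (size f)./2 = j.
Proof. by move/block_size ->; rewrite doubleK. Qed.

Lemma mem_fill k sigma q g m n u : is_matching k sigma -> connected k sigma ->
  q != [::] -> queue q m ->
  (forall m' n' v, m <= m' -> n' <= n -> v \in g m' n' <-> good sigma q m' n' v) ->
  u \in fill sigma g m n <-> pregood sigma q m n u.
Proof.
move=> mat conn q0 qm gP; split.
  case/allpairsPdep => f [v [/mem_fillings [j jn [blk [a b c]]]]].
  rewrite (size_half blk) => /(gP _ _ _ (leq_addr _ _) (leq_subr _ _)) gd ->.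
  exact: (pregood_fill mat conn qm jn blk).
case/lastP: q q0 qm gP => // q z _ qm gP /(pregood_split mat qm) [j [f [v]]].
case=> -> jn blk abc gd; apply/allpairsPdep; exists f, v; split=> //.
  by apply/mem_fillings; exists j.
by rewrite (size_half blk); apply/(gP _ _ _ (leq_addr _ _) (leq_subr _ _)).
Qed.

Lemma uniq_fill sigma q g m n : q != [::] -> queue q m ->
  (forall m' n' v, m <= m' -> n' <= n -> v \in g m' n' <-> good sigma q m' n' v) ->
  (forall m' n', m <= m' -> n' <= n -> uniq (g m' n')) ->
  uniq (fill sigma g m n).
Proof.
move=> q0 qm gP gU; apply: allpairs_uniq_dep => [|f _|].
- exact: uniq_fillings.
- by apply: gU; lia.
move=> p1 p2 /allpairsPdep [f1 [u1 [/mem_fillings [j1 _ [b1 _]] + ->]]].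
move=> + /allpairsPdep [f2 [u2 [/mem_fillings [j2 _ [b2 _]] + ->]]] /=.
rewrite (size_half b1) (size_half b2) => /(gP _ _ _ (leq_addr _ _) (leq_subr _ _)) g1.
move=> /(gP _ _ _ (leq_addr _ _) (leq_subr _ _)) g2 E.
have Ef := good_prefix_inj q0 qm b1 b2 g1 g2 E.
by subst f2; move/eqP: E; rewrite eqseq_cat // eqxx /= => /eqP ->.
Qed.

(** Induction on the fuel [d]: the bounded quantity is the number of letters still to be read, and
    each closing or opening consumes one. *)
Lemma suffixes_good k sigma : is_matching k sigma -> connected k sigma ->
  forall d q m n, queue q m -> n.*2 + size q < d ->
  (forall u, u \in suffixes sigma d q m n <-> good sigma q m n u) /\
  uniq (suffixes sigma d q m n).
Proof.
move=> mat conn; have [k0 _] := conn.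
have fillP d : (forall q m n, queue q m -> n.*2 + size q < d ->
    (forall u, u \in suffixes sigma d q m n <-> good sigma q m n u) /\
    uniq (suffixes sigma d q m n)) ->
  forall q m n, queue q m -> n.*2 + size q < d ->
    (forall u, u \in fill_queue sigma (suffixes sigma d) q m n <-> pregood sigma q m n u) /\
    uniq (fill_queue sigma (suffixes sigma d) q m n).
  move=> IH [|x q] m n qm lt /=.
    have [H ?] := IH _ _ _ qm lt; split=> // u; rewrite H.
    by split=> [[]|/pregood_nil].
  have gP m' n' : m <= m' -> n' <= n ->
    (forall v, v \in suffixes sigma d (x :: q) m' n' <-> good sigma (x :: q) m' n' v) /\
    uniq (suffixes sigma d (x :: q) m' n').
    by move=> le_m le_n; apply: IH; [exact: queue_leq_trans qm|lia].
  split=> [u|]; first by apply: (mem_fill _ mat conn) => // m' n' v lm ln; case: (gP m' n' lm ln).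
  by apply: (uniq_fill (q := x :: q)) => // m' n'; [move=> v|] => lm ln; case: (gP m' n' lm ln).
elim=> // d /fillP IH q m n qm lt.
have openP n' : n = n'.+1 ->
    (forall u, u \in fill_queue sigma (suffixes sigma d) (rcons q m.+1) m.+1 n' <->
      pregood sigma (rcons q m.+1) m.+1 n' u) /\
    uniq (fill_queue sigma (suffixes sigma d) (rcons q m.+1) m.+1 n').
  by move=> nE; apply: IH; [exact: queue_rcons|rewrite size_rcons; lia].
have closeP x q' : q = x :: q' ->
    (forall u, u \in fill_queue sigma (suffixes sigma d) q' m n <-> pregood sigma q' m n u) /\
    uniq (fill_queue sigma (suffixes sigma d) q' m n).
  move=> qE; apply: IH; last by rewrite qE /= in lt; lia.
  by move: qm; rewrite qE /queue /= => /andP [/andP [_ ->] /andP [_ ->]].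
have mq : m.+1 \notin q by apply/negP => /(queue_leq qm); rewrite ltnn.
rewrite /=; split=> [u|].
  rewrite mem_cat; split.
    case/orP.
      case: q qm lt openP closeP mq => [|x q] qm lt openP closeP mq.
        case: n lt openP closeP => // _ _ _; rewrite inE => /eqP ->.
        by apply: good_nil0; have /matchingP/block_size -> := mat; lia.
      case/mapP => v /(closeP x q erefl).1 pg ->; exact: (good_close mat k0).
    case: n lt openP closeP => // n lt openP closeP.
    by case/mapP => v /(openP n erefl).1 pg ->; apply: good_open.
  case: u => [/good_nil [-> ->] //|x u /(good_cons qm)].
  case=> [[q' qE pg]|[-> n0 pg]].
    by rewrite qE map_f //; apply/(closeP x q' qE).1.
  apply/orP; right; case: n n0 pg lt openP closeP => //= n _ pg lt openP closeP.
  by rewrite map_f //; apply/(openP n erefl).1.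
have cons_inj x : injective (@cons nat x) by move=> ? ? [].
rewrite cat_uniq; apply/and3P; split.
- case: q closeP {qm lt openP mq} => [|x q] closeP; first by case: (n).
  by rewrite map_inj_uniq //; case: (closeP x q erefl).
(* The closing and opening branches are disjoint, as their words start with a letter of [q] and with
   [m.+1] respectively. *)
- apply/hasPn => v; case: n {lt openP closeP} => // n /mapP [w _ ->].
  case: q mq {qm} => [|x q] mq //; apply/negP => /mapP [w' _ [Ex _]].
  by rewrite -Ex mem_head in mq.
case: n openP {lt closeP} => // n openP.
by rewrite map_inj_uniq //; case: (openP n erefl).
Qed.

(** * Power series *)

Local Open Scope ring_scope.

Definition ps0 : ps := fun _ => 0.
Definition psadd (f g : ps) : ps := fun n => f n + g n.
(** Coefficient [n] of a product involves only coefficients up to [n], so commutativity and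
    associativity are inherited from polynomials. *)
Definition pstrunc (N : nat) (f : ps) : {poly rat} := \poly_(i < N) f i.

Lemma coef_pstrunc N f n : (n < N)%N -> (pstrunc N f)`_n = f n.
Proof. by move=> lt_nN; rewrite coef_poly lt_nN. Qed.

Lemma psmul_trunc N f g n :
  (n < N)%N -> psmul f g n = (pstrunc N f * pstrunc N g)`_n.
Proof.
move=> ltnN; rewrite coefM; apply: eq_bigr => i _.
rewrite !coef_pstrunc //; first exact: leq_ltn_trans (leq_subr _ _) ltnN.
by apply: leq_ltn_trans ltnN; rewrite -ltnS.
Qed.

Lemma psmulC f g : psmul f g = psmul g f.
Proof.
by apply: functional_extensionality => n; rewrite !(@psmul_trunc n.+1) // mulrC.
Qed.

Lemma psmulA f g h : psmul f (psmul g h) = psmul (psmul f g) h.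
Proof.
apply: functional_extensionality => n.
have E : psmul f (psmul g h) n =
    (pstrunc n.+1 f * (pstrunc n.+1 g * pstrunc n.+1 h))`_n.
  rewrite coefM; apply: eq_bigr => i _.
  by rewrite coef_pstrunc // (@psmul_trunc n.+1) // ltnS leq_subr.
rewrite E mulrA coefM; apply: eq_bigr => i _.
by rewrite (@psmul_trunc n.+1) // coef_pstrunc // ltnS leq_subr.
Qed.

Lemma psmul1 f : psmul ps1 f = f.
Proof.
apply: functional_extensionality => n; rewrite /psmul big_ord_recl /ps1 mul1r subn0.
by rewrite big1 ?addr0 // => i _; rewrite mul0r.
Qed.

Lemma psmul0 f : psmul ps0 f = ps0.
Proof.
by apply: functional_extensionality => n; rewrite /psmul big1 // => i _; rewrite mul0r.
Qed.

Lemma psmulDl f g h : psmul (psadd f g) h = psadd (psmul f h) (psmul g h).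
Proof.
apply: functional_extensionality => n; rewrite /psmul /psadd -big_split.
by apply: eq_bigr => i _; rewrite mulrDl.
Qed.

Lemma ps_semi_ring : semi_ring_theory ps0 ps1 psadd psmul eq.
Proof.
constructor=> *; rewrite ?psmul1 ?psmul0 ?psmulA ?psmulDl //; first last.
- exact: psmulC.
- by apply: functional_extensionality => n; rewrite /psadd addrA.
- by apply: functional_extensionality => n; rewrite /psadd addrC.
- by apply: functional_extensionality => n; rewrite /psadd add0r.
Qed.
Add Ring ps_ring : ps_semi_ring.

Lemma psmulX f n : psmul psX f n = if n is n'.+1 then f n' else 0.
Proof.
case: n => [|n]; first by rewrite /psmul big_ord_recl big_ord0 mul0r addr0.
rewrite /psmul !big_ord_recl mul0r add0r mul1r big1 ?addr0 /= ?subSS ?subn0 //.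
by move=> i _; rewrite mul0r.
Qed.

Lemma pspowD f a b : pspow f (a + b) = psmul (pspow f a) (pspow f b).
Proof. by elim: a => [|a IH] /=; rewrite ?psmul1 // IH psmulA. Qed.

Lemma pspow_order f k n : f 0%N = 0 -> (n < k)%N -> pspow f k n = 0.
Proof.
move=> f0; elim: k n => // k IH n lt_nk /=.
rewrite /psmul big1 // => i _; case: (posnP i) => [->|i_gt0].
  by rewrite f0 mul0r.
rewrite IH ?mulr0 //; move: lt_nk (ltn_ord i); rewrite !ltnS => lt_nk le_in.
by apply: leq_trans lt_nk; rewrite ltn_subrL i_gt0 (leq_trans i_gt0).
Qed.

(** Common form of [psC_comp] (Catalan coefficients) and [ps_inv1m] (all coefficients 1). *)
Definition pscomp (a G : ps) : ps := fun n => \sum_(k < n.+1) a k * pspow G k n.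

Lemma pscomp_widen a G n N : G 0%N = 0 -> (n < N)%N ->
  pscomp a G n = \sum_(k < N) a k * pspow G k n.
Proof.
move=> G0 ltnN; rewrite /pscomp (big_ord_widen N (fun k => a k * pspow G k n)) //.
rewrite [RHS](bigID (fun k : 'I_N => k < n.+1)%N) /= [X in _ = _ + X]big1 ?addr0 //.
by move=> i; rewrite -leqNgt => lt_ni; rewrite pspow_order ?mulr0.
Qed.

(** All sums are given the common bound [N], and the terms are regrouped by the exponent
    [s = k + l]. *)
Lemma pscomp_mul a b G : G 0%N = 0 ->
  pscomp (psmul a b) G = psmul (pscomp a G) (pscomp b G).
Proof.
move=> G0; apply: functional_extensionality => n; set N := n.+1.
have -> : psmul (pscomp a G) (pscomp b G) n =
    \sum_(k < N) \sum_(l < N) a k * b l * pspow G (k + l) n.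
  transitivity (\sum_(i < N) \sum_(k < N) \sum_(l < N)
      a k * b l * (pspow G k i * pspow G l (n - i)%N)).
    apply: eq_bigr => i _; rewrite !(@pscomp_widen _ _ _ N) //; try by rewrite /N; lia.
    rewrite mulr_suml; apply: eq_bigr => k _; rewrite mulr_sumr.
    by apply: eq_bigr => l _; rewrite mulrACA.
  rewrite exchange_big /=; apply: eq_bigr => k _.
  rewrite exchange_big /=; apply: eq_bigr => l _.
  by rewrite -mulr_sumr pspowD.
transitivity (\sum_(s < N) \sum_(k < N | (k <= s)%N) a k * b (s - k)%N * pspow G s n).
  apply: eq_bigr => s _; rewrite /psmul mulr_suml.
  by rewrite (big_ord_widen N (fun i => a i * b (s - i)%N * pspow G s n)).
rewrite (exchange_big_dep predT) //=; apply: eq_bigr => k _.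
rewrite -(big_geq_mkord _ _ predT (fun s => a k * b (s - k)%N * pspow G s n)).
rewrite -(big_mkord predT (fun l => a k * b l * pspow G (k + l) n)).
(* The range of [l] is cut at [N - k]; beyond the cut, [k + l > n] and the power of [G] has no
   coefficient of degree [n]. *)
rewrite -{1}[k : nat]add0n big_addn (big_cat_nat (leq0n _) (leq_subr k N)) /=.
rewrite [X in _ = _ + X]big_nat_cond [X in _ = _ + X]big1 ?addr0.
  by apply: eq_bigr => i _; rewrite addnK addnC.
move=> i /andP [/andP [le_i _] _]; rewrite pspow_order ?mulr0 //.
by move: (ltn_ord k) le_i; rewrite /N; lia.
Qed.

Lemma pscompS a G n : G 0%N = 0 ->
  pscomp a G n = a 0%N * ps1 n + psmul G (pscomp (fun k => a k.+1) G) n.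
Proof.
move=> G0; rewrite (@pscomp_widen _ _ _ n.+2) // big_ord_recl; congr (_ + _).
rewrite /psmul; under [RHS]eq_bigr => i _ do
  rewrite (@pscomp_widen _ _ _ n.+1) ?ltnS ?leq_subr // mulr_sumr.
rewrite exchange_big; apply: eq_bigr => k _; rewrite /= /psmul mulr_sumr.
by apply: eq_bigr => i _; rewrite mulrCA.
Qed.

Lemma ps_inv1mE F : F 0%N = 0 ->
  ps_inv1m F = psadd ps1 (psmul F (ps_inv1m F)).
Proof.
move=> F0; have -> : ps_inv1m F = pscomp (fun _ => 1) F.
  by apply: functional_extensionality => n; apply: eq_bigr => k _; rewrite mul1r.
by apply: functional_extensionality => n; rewrite {1}pscompS // mul1r.
Qed.

(** The [k]-th power of the Catalan series, whose coefficient at [n > 0] is the ballot number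
    ['C(2n+k-1, n) - 'C(2n+k-1, n-1)]. Treating all powers together turns the quadratic equation for
    [C] into a linear recurrence in [k]. *)
Definition ballot (k : nat) : ps := fun n =>
  if n is n'.+1 then
    'C(n'.*2 + k.+1, n'.+1)%:R - 'C(n'.*2 + k.+1, n')%:R
  else 1.

(** Pascal's rule on both binomials; on series it reads [C^(k+1) = C^k + z C^(k+2)]. *)
Lemma ballotS k n : ballot k.+1 n =
  ballot k n + (if n is n'.+1 then ballot k.+2 n' else 0).
Proof.
case: n => [|[|n]] /=; rewrite ?addr0 //.
  by rewrite !bin1 !bin0 !add0n -addn1 natrD addrAC.
rewrite !(doubleS, addnS, addSn) (binS _.+3 n.+1) (binS _.+3 n) !natrD.
by rewrite opprD addrACA.
Qed.

Lemma ballot0 : ballot 0 = ps1.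
Proof.
apply: functional_extensionality => -[|n] //=.
have {1}-> : (n.+1 = n.*2 + 1 - n)%N by lia.
by rewrite bin_sub ?subrr //; lia.
Qed.

Lemma ballot1 n : ballot 1 n = catalan_coef n.
Proof.
case: n => [|n]; rewrite /ballot /catalan_coef ?divr1 //.
rewrite addn2 -doubleS; apply: (@mulIf _ n.+2%:R); first by rewrite pnatr_eq0.
rewrite divfK ?pnatr_eq0 // mulrBl.
(* This is [(n+1) 'C(2n+2, n+1) = (n+2) 'C(2n+2, n)], which eliminates the second binomial of the
   ballot number. *)
have /(congr1 (fun x => x%:R : rat)) := mul_bin_left n.+1.*2 n.
rewrite !natrM (_ : n.+1.*2 - n = n.+2)%N; last lia.
by rewrite mulrC => E; rewrite [X in _ - X]mulrC -E -mulrBr -natrB ?leqnSn // subSnn mulr1.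
Qed.

(* Both sides satisfy [g (k+1) n = g k n + g (k+2) (n-1)] with the same values at [k = 0]. *)
Lemma ballot_mul k : psmul (ballot k) (ballot 1) = ballot k.+1.
Proof.
have step j : ballot j.+1 = psadd (ballot j) (psmul psX (ballot j.+2)).
  by apply: functional_extensionality => n; rewrite /psadd psmulX ballotS.
have prod_step j n : psmul (ballot j.+1) (ballot 1) n =
    psmul (ballot j) (ballot 1) n +
    (if n is n'.+1 then psmul (ballot j.+2) (ballot 1) n' else 0).
  by rewrite step psmulDl -psmulA /psadd psmulX.
apply: functional_extensionality => n; elim: n k => [|n IHn] k.
all: elim: k => [|k IHk]; first by rewrite ballot0 psmul1.
  by rewrite prod_step IHk [RHS]ballotS.
by rewrite prod_step IHk IHn [RHS]ballotS.
Qed.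

(** The equation [C = 1 + z C^2] evaluated at [G]: removing the constant term of [ballot 1] and
    shifting gives [ballot 2], the square of [ballot 1]. *)
Lemma psC_compE G : G 0%N = 0 ->
  psC_comp G = psadd ps1 (psmul G (psmul (psC_comp G) (psC_comp G))).
Proof.
move=> G0; have -> : psC_comp G = pscomp (ballot 1) G.
  by apply: functional_extensionality => n; apply: eq_bigr => k _; rewrite ballot1.
rewrite -pscomp_mul // ballot_mul; apply: functional_extensionality => n.
rewrite pscompS // mul1r /psadd; congr (_ + psmul _ (pscomp _ _) _).
apply: functional_extensionality => m; by rewrite ballotS ballot0 add0r.
Qed.

(* Generating function of the admissible suffixes when [h] outer edges are open. *)
Definition queue_series (M : ps) (h : nat) : ps :=
  let zM := psmul psX M in
  let C := psC_comp (psmul zM M) in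
  let W := ps_inv1m (psmul zM C) in
  if h is h'.+1 then psmul (pspow (psmul M C) h') (psmul C W) else W.

Lemma queue_series_rec M h :
  queue_series M h =
  psadd (if h is h'.+1 then
           if h' is 0 then queue_series M 0 else psmul M (queue_series M h')
         else ps1)
        (psmul psX (psmul M (queue_series M h.+1))).
Proof.
have shift0 f g : psmul (psmul psX f) g 0%N = 0.
  by rewrite -psmulA psmulX.
have CE := psC_compE (shift0 M M).
case: h => [|h]; rewrite /queue_series.
  by rewrite {1}ps_inv1mE // /pspow psmul1 !psmulA.
(* For [h > 0] only the functional equation of [C] matters; [W] is a common factor and may be
   arbitrary. *)
move: (psC_comp _) CE (ps_inv1m _) => C CE W.
case: h => [|h] /=; first by rewrite {1}CE; ring.
by move: (pspow _ h) => P; rewrite {1}CE; ring.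
Qed.

(** * Counting suffixes by series *)

Lemma size_fill sigma g W m n :
  (forall m' n', (n' <= n)%N -> (m <= m')%N -> (size (g m' n'))%:R = W n' :> rat) ->
  (size (fill sigma g m n))%:R = psmul (Mgf [:: sigma; chi; chibar]) W n.
Proof.
move=> gW; rewrite size_allpairs_dep sumnE big_map big_allpairs_dep.
rewrite natr_sum (_ : iota 0 n.+1 = index_iota 0 n.+1) ?big_mkord; last by rewrite /index_iota subn0.
apply: eq_bigr => j _.
rewrite natr_sum (eq_big_seq (fun=> W (n - j)%N)).
  by rewrite big_const_seq count_predT size_mlist iter_addr_0 -mulr_natl.
move=> w /mlist_sigma [/block_size szw _ _ _].
by rewrite size_map szw doubleK gW ?leq_subr ?leq_addr.
Qed.

(** The lists and the series obey the same recurrence, in which only the length of the queue enters,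
    not its letters or [m]. *)
Lemma size_suffixes sigma d q m n : (n.*2 + size q < d)%N ->
  (size (suffixes sigma d q m n))%:R =
    queue_series (Mgf [:: sigma; chi; chibar]) (size q) n.
Proof.
set M := Mgf _; elim: d q m n => // d IH q m n lt.
have fillE q' m' n' : (n'.*2 + size q' < d)%N ->
    (size (fill_queue sigma (suffixes sigma d) q' m' n'))%:R =
    (if q' is [::] then queue_series M 0 else psmul M (queue_series M (size q'))) n'.
  case: q' => [|x q'] lt' /=; first exact: IH.
  by apply: size_fill => m1 n1 le1 _; rewrite IH //=; move: lt' => /=; lia.
rewrite queue_series_rec /psadd psmulX /= size_cat natrD; congr (_ + _).
  case: q lt => [|x q] lt; first by case: n {lt}.
  rewrite size_map fillE; last by move: lt => /=; lia.
  by case: q lt.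
case: n lt => // n lt; rewrite size_map fillE; last by rewrite size_rcons; lia.
by rewrite size_rcons; case: (q).
Qed.

Theorem theorem2 (k : nat) (sigma : seq nat) :
  is_matching k sigma -> connected k sigma ->
  let M := Mgf [:: sigma; chi; chibar] in
  let zM := psmul psX M in
  Mgf [:: lifting sigma; chi; chibar]
  = ps_inv1m (psmul zM (psC_comp (psmul zM M))).
Proof.
move=> mat conn M zM; apply: functional_extensionality => n.
have lt : (n.*2 + size (Nil nat) < n.*2.+1)%N by rewrite addn0.
have [memE uq] := suffixes_good mat conn (isT : queue [::] 0) lt.
(* The right-hand side is [queue_series M 0] by definition. With nothing read and an empty queue,
   the good suffixes are exactly the avoiding matchings. *)
transitivity (queue_series M 0 n) => //.
rewrite -(size_suffixes sigma 0 lt) /Mgf -size_mlist; congr (_ %:R).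
apply/perm_size/uniq_perm => // [|w]; first exact: uniq_mlist.
apply/idP/idP => [/mlist_lifting [[can cnt] av]|/memE [[cnt can _ av] _]].
  by apply/memE/pregood_nil; split=> //; rewrite sub0seq.
by apply/mlist_lifting.
Qed.
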